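(* Let $G$ be a finite solvable group and let $\chi \in \operatorname{Irr}(G)$. Then $\chi(1)$ has at most $\eta(\chi)$ distinct prime divisors. If, in addition, $G$ is supersolvable and $\chi(1)>1$, then $\chi(1)$ is a product of at most $\eta(\chi)-1$ (not necessarily distinct) primes.
   Context: $\operatorname{Irr}(G)$ is the set of irreducible complex characters of the finite group $G$, and $\overline{\chi}$ is the complex conjugate of $\chi$. For $\chi\in\operatorname{Irr}(G)$, $\eta(\chi)$ denotes the number of distinct non-principal irreducible constituents of the character $\chi\overline{\chi}$ (so $\eta(\chi)=0$ if $\chi(1)=1$). *)

(* Defs.v *)
From HB Require Import structures.
From mathcomp Require Import all_boot all_order all_fingroup all_algebra.
From mathcomp Require Import all_solvable all_field all_character.

Set Implicit Arguments.
Unset Strict Implicit.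
Unset Printing Implicit Defensive.

Import GroupScope GRing.Theory Num.Theory.
Local Open Scope ring_scope.

Definition cyclic_factor (gT : finGroupType) (A V U : {set gT}) : bool :=
  [&& V <| A, U <| A, V \subset U & cyclic (U / V)].

(* The terms of the series are normal in the whole group G, not merely each   *)
(* in the next one (the latter would only characterise solvability).          *)
Definition supersolvable (gT : finGroupType) (G : {group gT}) : Prop :=
  exists2 s : seq {group gT},
    (cyclic_factor G).-series 1%G s & last 1%G s = G.

(* 'chi_0 is the principal character of G.                                    *)
Definition eta (gT : finGroupType) (G : {group gT}) (chi : 'CF(G)) : nat :=
  #|[set i in irr_constt (chi * chi^*%CF) | i != 0]|.

(* Main.v *)
Require Import Defs.
From mathcomp Require Import all_boot all_order all_fingroup all_algebra.
From mathcomp Require Import all_solvable all_field all_character.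

Set Implicit Arguments.
Unset Strict Implicit.
Unset Printing Implicit Defensive.

Import GroupScope GRing.Theory Num.Theory.
Local Open Scope ring_scope.

(* Write X for chi times its conjugate and, for N normal in G, let K(N) be the
   set of nonprincipal constituents of X whose kernel contains N; it grows from
   the empty set at N = G to all eta(chi) constituents at N = 1.  Let M <= N be
   normal in G and let theta be a constituent of chi_N that is reducible on M.
   Then 1_M has multiplicity [theta_M, theta_M] > 1 in the restriction to M of
   theta times its conjugate, so some nonprincipal constituent of this product
   contains 1_M on M; it lies under some alpha in K(M) but not in K(N).  Hence,
   along a normal series, every drop in the degree of the constituents of the
   restrictions of chi uses up a new element of K.

   Along a chief series of a solvable group each drop is a power of one prime.
   In the supersolvable case the series can be refined to prime indices, so each
   drop is a single prime.  Moreover, at the last drop, from N to M, K(M) is not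
   everything: otherwise M is in the kernel of X and theta_M is homogeneous,
   whereas it is a sum of |N : M| distinct irreducibles.  This saves one
   constituent. *)

(** * Normal subgroups of prime index and restriction to them *)

Lemma solvable_quotient_prime_index (gT : finGroupType) (N M : {group gT}) :
    M <| N -> solvable (N / M) -> M != N ->
  exists L : {group gT}, [/\ L <| N, M \subset L & prime #|N : L|].
Proof.
move=> nsMN solNM neqMN; have [sMN nMN] := andP nsMN.
have ntNM: (N / M)%g != 1%g.
  rewrite -subG1 quotient_sub1 //; apply: contra neqMN => sNM.
  by rewrite -val_eqE eqEsubset sMN.
have [Lq nsLq pr_L] := sol_prime_factor_exists solNM ntNM.
have [L defL sML nsLN] := inv_quotientN nsMN nsLq.
exists L; split=> //; move: pr_L.
rewrite defL index_quotient_eq //; last exact: normal_sub.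
exact: subset_trans (subsetIr _ _) sML.
Qed.

(** Subgroups of the cyclic group [N / M] are characteristic, so the [L] of prime index found in [N]
    is normal in all of [G], and the refinement can be repeated below [L]. *)
Lemma cyclic_factor_prime_index (gT : finGroupType) (G N M : {group gT}) :
    cyclic_factor G M N -> M != N ->
  exists L : {group gT},
    [/\ cyclic_factor G M L, L <| G, L \subset N & prime #|N : L|].
Proof.
case/and4P=> nsMG nsNG sMN cycNM neqMN.
have nsMN: M <| N by apply: normalS nsMG => //; apply: normal_sub.
have [|L [nsLN sML prL]] := solvable_quotient_prime_index nsMN _ neqMN.
  by apply/abelian_sol/cyclic_abelian.
have sLN := normal_sub nsLN.
have charL: (L / M)%g \char (N / M)%g by rewrite sub_cyclic_char ?quotientS.
have nsLG: L <| G.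
  have nsLMq: (L / M)%g <| (G / M)%g.
    by apply: char_normal_trans charL _; apply: quotient_normal.
  rewrite -(quotientGK (normalS sML (subset_trans sLN (normal_sub nsNG)) nsMG)).
  by rewrite -(quotientGK nsMG) cosetpre_normal.
exists L; split=> //; rewrite /cyclic_factor nsMG nsLG sML /=.
by rewrite (cyclicS _ cycNM) ?quotientS.
Qed.

Lemma constt_normal_Res1 (gT : finGroupType) (G N : {group gT}) i j k :
    N <| G -> j \in irr_constt ('Res[N] 'chi[G]_i) ->
    k \in irr_constt ('Res[N] 'chi[G]_i) ->
  'chi_k 1%g = 'chi_j 1%g.
Proof.
move=> nsNG Cj; rewrite irr_consttE (Clifford_Res_sum_cfclass nsNG Cj).
rewrite cfdotZl reindex_cfclass // cfdot_suml.
have [/cfclassP[y _ ->] _|notCk] := boolP ('chi_k \in ('chi_j ^: G)%CF).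
  by rewrite cfConjg1.
rewrite big1 ?mulr0 ?eqxx // => l Cl; rewrite cfdot_irr; case: eqP => // Dl.
by rewrite -Dl Cl in notCk.
Qed.

(** A reducible restriction is a sum of [#|G : N|] distinct irreducibles: the norm counts them, and
    by Clifford's theorem they share one degree. *)
Lemma prime_index_constt_Res (gT : finGroupType) (G N : {group gT}) i j :
    N <| G -> prime #|G : N| -> j \in irr_constt ('Res[N] 'chi[G]_i) ->
  'Res[N] 'chi_i = 'chi_j \/
  [/\ '['Res[N] 'chi_i] = #|G : N|%:R & 'chi_i 1%g = #|G : N|%:R * 'chi_j 1%g].
Proof.
move=> nsNG prN Cj.
have [/irrP[k Dk] | [c injc Dc]] := cfRes_prime_irr_cases i nsNG erefl prN.
  by left; move: Cj; rewrite Dk constt_irr => /eqP->.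
right; split.
  rewrite {1}Dc cfdot_suml -[in RHS](card_ord #|G : N|) -sum1_card natr_sum.
  apply: eq_bigr => k _; rewrite Dc cfdot_sumr (bigD1 k) //= cfnorm_irr.
  rewrite big1 ?addr0 // => l /negbTE.
  by rewrite cfdot_irr (inj_eq injc) eq_sym => ->.
have Cc k : c k \in irr_constt ('Res[N] 'chi_i).
  rewrite irr_consttE Dc cfdot_suml (bigD1 k) //= cfnorm_irr.
  rewrite big1 ?addr0 ?oner_eq0 // => l /negbTE.
  by rewrite cfdot_irr (inj_eq injc) => ->.
rewrite -(cfRes1 N) Dc sum_cfunE (eq_bigr (fun=> 'chi_j 1%g)); last first.
  by move=> k _; apply: constt_normal_Res1 (Cc k).
by rewrite sumr_const card_ord mulr_natl.
Qed.

Lemma constt_Res_chain (gT : finGroupType) (N L M : {group gT})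
    (psi : 'CF(N)) j :
    M \subset L -> L \subset N -> j \in irr_constt ('Res[M] psi) ->
  exists2 k, k \in irr_constt ('Res[L] psi)
           & j \in irr_constt ('Res[M] 'chi[L]_k).
Proof.
move=> sML sLN Cj; apply/exists_inP; apply: contraLR Cj => /exists_inPn noC.
rewrite irr_consttE negbK -(cfResRes _ sML sLN) ['Res[L] _]cfun_sum_constt.
rewrite linear_sum cfdot_suml big1 //= => k Ck.
rewrite linearZ cfdotZl; have:= noC k Ck; rewrite irr_consttE negbK => /eqP->.
by rewrite mulr0.
Qed.

Lemma irr_constt_addl (gT : finGroupType) (G : {group gT}) (psi rho : 'CF(G)) :
    psi \is a character -> rho \is a character ->
  {subset irr_constt psi <= irr_constt (psi + rho)}.
Proof.
move=> Npsi Nrho i /(constt_charP _ Npsi)[psi1 Npsi1 Dpsi].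
apply/constt_charP; rewrite ?rpredD //.
by exists (psi1 + rho); rewrite ?rpredD // Dpsi addrA.
Qed.

(** Descend by steps of prime index: each one keeps the degree or divides it by that index, a prime
    divisor of [#|N : M|]. *)
Lemma irr1_constt_Res_pnat (gT : finGroupType) (pi : nat_pred)
    (N M : {group gT}) i j :
    M <| N -> solvable (N / M) -> pi.-nat #|N : M| ->
    j \in irr_constt ('Res[M] 'chi[N]_i) ->
  exists2 m, pi.-nat m & 'chi_i 1%g = m%:R * 'chi_j 1%g.
Proof.
have [n] := ubnP #|N : M|; elim: n => // n IHn in N i *.
move=> ltNn nsMN solNM pi_NM Cj.
have [eqMN | neqMN] := eqVneq M N.
  subst N; exists 1%N => //; rewrite mul1r.
  by move: Cj; rewrite cfRes_id constt_irr => /eqP->.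
have [L [nsLN sML prL]] := solvable_quotient_prime_index nsMN solNM neqMN.
have sLN := normal_sub nsLN; have nsML := normalS sML sLN nsMN.
have DNM := Lagrange_index sLN sML.
have [k Ck Ckj] := constt_Res_chain sML sLN Cj.
move: pi_NM; rewrite -DNM pnatM => /andP[pi_NL pi_LM].
have [|//||//|//|m pi_m Dk] := IHn L k;
  rewrite ?(solvableS _ solNM) ?quotientS //.
  rewrite -ltnS; apply: leq_trans ltNn; rewrite ltnS -DNM.
  by rewrite ltn_Pmull ?prime_gt1 ?indexg_gt0.
have [Dres | [_ Di]] := prime_index_constt_Res nsLN prL Ck.
  by exists m; rewrite // -(cfRes1 L) Dres.
by exists (#|N : L| * m)%N; rewrite ?pnatM ?pi_NL // Di Dk natrM mulrA.
Qed.

Lemma cfdot_mul_conjC (gT : finGroupType) (G : {group gT}) (psi : 'CF(G)) :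
  '[psi * psi^*%CF, 1] = '[psi].
Proof.
rewrite cfdotE; congr (_ * _); apply: eq_bigr => x Gx.
by rewrite !cfunE cfun1E Gx rmorph1 mulr1.
Qed.

(** * The sets K(N) and their growth *)

Section ConsttKer.

Variables (gT : finGroupType) (G : {group gT}) (chi : 'CF(G)).
Hypothesis Nchi : chi \is a character.

Definition constt_ker (N : {set gT}) : {set Iirr G} :=
  [set i in irr_constt (chi * chi^*%CF) | (i != 0) && (N \subset cfker 'chi_i)].

Let Nchi2 : chi * chi^*%CF \is a character.
Proof. by rewrite rpredM ?cfConjC_char. Qed.

Lemma constt_kerS (M N : {set gT}) :
  M \subset N -> constt_ker N \subset constt_ker M.
Proof.
move=> sMN; apply/subsetP=> i; rewrite !inE => /and3P[-> -> sNi].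
exact: subset_trans sNi.
Qed.

Lemma card_constt_ker_eta (N : {set gT}) : (#|constt_ker N| <= eta chi)%N.
Proof. by apply/subset_leq_card/subsetP=> i; rewrite !inE => /and3P[-> ->]. Qed.

(** At the top of a series the K term thus disappears from the bounds. *)
Lemma card_constt_kerG : #|constt_ker G| = 0%N.
Proof.
apply: eq_card0 => i; rewrite !inE; apply/and3P=> [[_ nz_i sGi]].
case/eqP: nz_i; apply: irr_inj; rewrite irr0; apply/eqP.
rewrite -(cfRes_id 'chi_i) cfRes_sub_ker //.
have: 'chi_i \is a linear_char.
  by rewrite lin_irr_der1 (subset_trans (der_sub _ _)).
by move/lin_char1->; rewrite scale1r.
Qed.

Lemma constt_ker_full (M : {set gT}) :
    M \subset G -> #|constt_ker M| = eta chi ->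
  M \subset cfker (chi * chi^*%CF).
Proof.
move=> sMG eqK; rewrite cfkerE // subsetI sMG /=; apply/bigcapsP=> i Ci.
have [-> | nz_i] := eqVneq i 0; first by rewrite cfker_irr0.
have sK: constt_ker M \subset [set i in irr_constt (chi * chi^*%CF) | i != 0].
  by apply/subsetP=> k; rewrite !inE => /and3P[-> ->].
have /eqP DK: constt_ker M == [set i in irr_constt (chi * chi^*%CF) | i != 0].
  by rewrite eqEcard sK eqK /=.
have: i \in constt_ker M by rewrite DK inE Ci.
by rewrite inE => /and3P[].
Qed.

Variables (N : {group gT}) (t : Iirr N).
Hypotheses (nsNG : N <| G) (Ct : t \in irr_constt ('Res[N] chi)).

Let Nt2 : 'chi_t * ('chi_t)^*%CF \is a character.
Proof. by rewrite rpredM ?cfConjC_char ?irr_char. Qed.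

Lemma Res_mul_conjC_sub :
  exists2 psi, psi \is a character
  & 'Res[N] (chi * chi^*%CF) = 'chi_t * ('chi_t)^*%CF + psi.
Proof.
have [phi Nphi Dphi] := constt_charP t (cfRes_char N Nchi) Ct.
exists ('chi_t * phi^*%CF + phi * ('chi_t + phi)^*%CF).
  by rewrite !(rpredM, rpredD) ?cfConjC_char ?rpredD ?irr_char.
by rewrite rmorphM /= -conj_cfRes Dphi rmorphD /= mulrDl addrA -mulrDr.
Qed.

(** Let p be the index and d the degree of ['chi_j]. If the restriction were reducible, ['chi_t]
    times its conjugate would restrict to (pd)^2 times 1_M, while the multiplicity of 1_M is the
    norm p; but p = (pd)^2 fails for p > 1. *)
Lemma ker_mul_conjC_prime_index (M : {group gT}) (j : Iirr M) :
    M \subset cfker (chi * chi^*%CF) -> M <| N -> prime #|N : M| ->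
    j \in irr_constt ('Res[M] 'chi_t) ->
  'Res[M] 'chi_t = 'chi_j.
Proof.
move=> kerM nsMN prM Cj.
have [// | [Dnorm Dt1]] := prime_index_constt_Res nsMN prM Cj.
have sMN := normal_sub nsMN.
have [psi Npsi Dpsi] := Res_mul_conjC_sub.
have kerMt: M \subset cfker ('chi_t * ('chi_t)^*%CF).
  have: M \subset cfker ('Res[N] (chi * chi^*%CF)) by apply: sub_cfker_Res.
  rewrite Dpsi !cfkerE ?rpredD // !subsetI sMN => /bigcapsP sMi.
  by apply/bigcapsP=> i Ci; apply: sMi; apply: irr_constt_addl.
have:= congr1 (fun phi => '[phi, 1]) (cfRes_sub_ker kerMt).
rewrite rmorphM /= -conj_cfRes.
rewrite cfdot_mul_conjC Dnorm cfdotZl cfnorm1 mulr1 cfunE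
  cfConjC_char1 ?irr_char // Dt1.
have /natrP[d Dd] := Cnat_irr1 j; rewrite Dd -!natrM => /eqP.
rewrite eqr_nat => /eqP Dp.
have d_gt0: (0 < d)%N by rewrite -(ltr0n algC) -Dd irr1_gt0.
have:= prime_gt1 prM; rewrite ltnNge => /negP[].
(* Multiplied by p, the goal p <= 1 becomes p^2 <= p = (pd)^2. *)
rewrite -(leq_pmul2l (prime_gt0 prM)) muln1 {3}Dp.
by rewrite mulnACA leq_pmulr ?muln_gt0 ?d_gt0.
Qed.

Lemma constt_ker_ltn (M : {group gT}) (j : Iirr M) :
    M <| G -> M \subset N -> j \in irr_constt ('Res[M] 'chi_t) ->
    'Res[M] 'chi_t != 'chi_j ->
  (#|constt_ker N| < #|constt_ker M|)%N.
Proof.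
move=> nsMG sMN Cj redM; have sNG := normal_sub nsNG.
have C0: 0 \in irr_constt ('chi_t * ('chi_t)^*%CF).
  by rewrite irr_consttE irr0 cfdot_mul_conjC cfnorm_irr oner_eq0.
(* Removing 1_N, which occurs only once because ['chi_t] is irreducible, leaves [zeta]. *)
have [zeta Nzeta Dzeta] := constt_charP _ Nt2 C0; rewrite irr0 in Dzeta.
have zeta0: '[zeta, 1] = 0.
  apply: (addrI 1); rewrite -[in LHS](cfnorm1 N) -cfdotDl -Dzeta.
  by rewrite cfdot_mul_conjC cfnorm_irr addr0.
have zetaM: 0 \in irr_constt ('Res[M] zeta).
  have Dres: 'Res[M] 'chi_t * ('Res[M] 'chi_t)^*%CF = 1 + 'Res[M] zeta.
    by rewrite conj_cfRes -rmorphM /= Dzeta rmorphD rmorph1.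
  (* Were 1_M absent from [zeta] on [M], the restriction of ['chi_t] would have norm 1 and be
     irreducible. *)
  rewrite irr_consttE irr0; apply: contra redM => /eqP zM0.
  have /irrP[k Dk]: 'Res[M] 'chi_t \in irr M.
    rewrite irrEchar cfRes_char ?irr_char //= -cfdot_mul_conjC Dres.
    by rewrite cfdotDl cfnorm1 zM0 addr0.
  by move: Cj; rewrite Dk constt_irr => /eqP->.
have [b] := constt_Res_chain sMN (subxx N) zetaM; rewrite cfRes_id => Cb C0b.
have nz_b: b != 0.
  by apply: contraTneq Cb => ->; rewrite irr_consttE irr0 zeta0 eqxx.
have [psi Npsi Dpsi] := Res_mul_conjC_sub.
have CbN: b \in irr_constt ('Res[N] (chi * chi^*%CF)).
  rewrite Dpsi; apply: irr_constt_addl => //; rewrite Dzeta addrC.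
  by apply: irr_constt_addl; rewrite ?cfun1_char.
have [a] := constt_Res_chain sNG (subxx G) CbN; rewrite cfRes_id => Ca Cab.
(* On [M], ['chi_a] contains 1_M; as [M] is normal in [G], this puts [M] in its kernel. *)
have kerMa: M \subset cfker 'chi_a.
  apply: constt0_Res_cfker nsMG _; rewrite -(cfResRes _ sMN sNG).
  by apply: constt_Res_trans Cab _ C0b; rewrite cfRes_char ?irr_char.
(* With [N] in its kernel, ['chi_a] would restrict to a multiple of 1_N and could not contain the
   nonprincipal ['chi_b]. *)
have kerNa: ~~ (N \subset cfker 'chi_a).
  apply: contraL Cab => kerNa; rewrite irr_consttE negbK cfRes_sub_ker //.
  by rewrite cfdotZl -irr0 cfdot_irr (eq_sym 0) (negbTE nz_b) mulr0.
apply/proper_card/properP; split; first exact: constt_kerS.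
exists a; last by rewrite inE (negbTE kerNa) !andbF.
rewrite inE Ca kerMa andbT.
by apply: contraNneq kerNa => ->; rewrite cfker_irr0.
Qed.

End ConsttKer.

(** * Bounds along chief series and series with cyclic factors *)

Lemma irr_trivial_subgroup1 (gT : finGroupType) (i : Iirr [1 gT]) :
  'chi_i 1%g = 1.
Proof. by have /char_abelianP/(_ i)/lin_char1 := abelian1 gT. Qed.

Section SeriesBounds.

Variables (gT : finGroupType) (G : {group gT}) (chi : 'CF(G)).
Hypothesis Nchi : chi \is a character.

(** Going up the series, a chief factor is a p-group for some prime p. If the restriction is
    reducible there, the degree gains at most the prime divisor p while K loses at least one
    element. *)
Lemma chief_series_primes_leq (s : seq {group gT}) :
    solvable G -> (G.-chief).-series 1%G s ->
    forall t, t \in irr_constt ('Res[last 1%G s] chi) ->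
  exists2 d : nat, 'chi_t 1%g = d%:R
    & (size (primes d) + #|constt_ker chi (last 1%G s)| <= eta chi)%N.
Proof.
move=> solG; elim/last_ind: s => [_ t _ | s N IHs].
  by exists 1%N; rewrite ?irr_trivial_subgroup1 ?card_constt_ker_eta.
rewrite rcons_path last_rcons => /andP[/IHs{}IHs].
set M := last _ _ in IHs * => chiefMN t Ct.
have minNM := chief_factor_minnormal chiefMN.
case/andP: chiefMN => /maxgroupp/andP[/andP[sMN _] nMG] nsNG.
have sNG := normal_sub nsNG.
have nsMG: M <| G by rewrite /normal (subset_trans sMN).
have nsMN := normalS sMN sNG nsMG.
have solNM: solvable (N / M) by rewrite quotient_sol ?(solvableS sNG).
have [_ _ /is_abelemP[p pr_p /abelem_pgroup]] :=
  minnormal_solvable minNM (subxx _) solNM.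
rewrite /pgroup card_quotient ?normal_norm // => pNM.
have [j Cj] := constt_cfRes_irr M t.
have [|d Dd le_d] := IHs j.
  rewrite -(cfResRes _ sMN sNG); apply: constt_Res_trans Ct _ Cj.
  exact: cfRes_char.
have [Dres | redM] := eqVneq ('Res[M] 'chi_t) 'chi_j.
  exists d; first by rewrite -Dd -Dres cfRes1.
  by apply: leq_trans le_d; rewrite leq_add2l subset_leq_card ?constt_kerS.
have [m p_m Dt] := irr1_constt_Res_pnat nsMN solNM pNM Cj.
have ltK := constt_ker_ltn Nchi nsNG Ct nsMG sMN Cj redM.
exists (m * d)%N; first by rewrite Dt Dd natrM.
apply: leq_trans le_d; apply: leq_trans (leq_add (leqnn _) ltK).
(* The prime [p] may already divide [d], so only an inclusion of prime divisors is claimed. *)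
rewrite addnS -addSn leq_add2r -/(size (p :: primes d)).
have d_gt0: (0 < d)%N by rewrite -(ltr0n algC) -Dd irr1_gt0.
have [m_gt0 _] := andP p_m.
apply: uniq_leq_size (primes_uniq _) _ => q.
rewrite primesM // inE => /orP[q_m | ->]; last exact: orbT.
by have /eqP-> := pnatPpi p_m q_m; rewrite eqxx.
Qed.

(* The summand (s != [::]) carries the constituent saved at the last drop. *)
Definition prime_product_bound (N : {group gT}) : Prop :=
  forall t, t \in irr_constt ('Res[N] chi) ->
  exists s : seq nat, [/\ all prime s, 'chi_t 1%g = (\prod_(p <- s) p)%N%:R
    & (size s + (s != [::]) + #|constt_ker chi N| <= eta chi)%N].

Lemma prime_product_bound_step (M N : {group gT}) :
    M <| G -> N <| G -> M \subset N -> prime #|N : M| ->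
  prime_product_bound M -> prime_product_bound N.
Proof.
move=> nsMG nsNG sMN prM IHM t Ct; have sNG := normal_sub nsNG.
have nsMN := normalS sMN sNG nsMG.
have [j Cj] := constt_cfRes_irr M t.
have [|s [pr_s Dj le_s]] := IHM j.
  rewrite -(cfResRes _ sMN sNG); apply: constt_Res_trans Ct _ Cj.
  exact: cfRes_char.
have [Dres | redM] := eqVneq ('Res[M] 'chi_t) 'chi_j.
  exists s; split=> //; first by rewrite -Dj -Dres cfRes1.
  by apply: leq_trans le_s; rewrite leq_add2l subset_leq_card ?constt_kerS.
have ltK := constt_ker_ltn Nchi nsNG Ct nsMG sMN Cj redM.
have [Dres | [_ Dt]] := prime_index_constt_Res nsMN prM Cj.
  by rewrite Dres eqxx in redM.
exists (#|N : M| :: s); split; first by rewrite /= prM.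
  by rewrite big_cons natrM -Dj.
(* For nonempty [s] the extra summand is already present, and the new prime is paid for by [ltK]. *)
have [s0 | nz_s] := eqVneq s [::]; last first.
  rewrite nz_s in le_s; apply: leq_trans le_s => /=.
  by rewrite addSn addSnnS leq_add2l.
(* The first prime also brings in the extra summand, so two constituents are needed: K(N) < K(M) <
   eta in cardinality. Equality on the right would put [M] in the kernel of chi times its conjugate,
   making the restriction irreducible. *)
rewrite s0 /= in le_s *; rewrite !add1n.
rewrite (leq_trans (n := #|constt_ker chi M|.+1)) ?ltnS //.
rewrite ltn_neqAle card_constt_ker_eta andbT; apply: contraNneq redM => eqK.
have kerM := constt_ker_full Nchi (normal_sub nsMG) eqK.
by rewrite (ker_mul_conjC_prime_index Nchi Ct kerM nsMN prM Cj).
Qed.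

(** A cyclic factor may have composite order; it is climbed in steps of prime index. *)
Lemma prime_product_bound_cyclic (M N : {group gT}) :
  cyclic_factor G M N -> prime_product_bound M -> prime_product_bound N.
Proof.
have [n] := ubnP #|N|; elim: n => // n IHn in N * => ltNn cycMN boundM.
have [<- // | neqMN] := eqVneq M N.
have [L [cycML nsLG sLN prL]] := cyclic_factor_prime_index cycMN neqMN.
have nsNG: N <| G by case/and4P: cycMN.
apply: (prime_product_bound_step nsLG) => //; apply: IHn => //.
rewrite -ltnS; apply: leq_trans ltNn; rewrite ltnS -(Lagrange sLN).
by rewrite ltn_Pmulr ?prime_gt1 ?cardG_gt0.
Qed.

Lemma cyclic_series_prime_product_bound (s : seq {group gT}) :
    (cyclic_factor G).-series 1%G s -> prime_product_bound (last 1%G s).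
Proof.
elim/last_ind: s => [_ t _ | s N IHs].
  exists [::]; rewrite big_nil irr_trivial_subgroup1; split=> //.
  exact: card_constt_ker_eta.
rewrite rcons_path last_rcons => /andP[/IHs{}IHs cycN].
exact: prime_product_bound_cyclic cycN IHs.
Qed.

End SeriesBounds.

(* Irreducible character degrees are natural numbers of algC (Cnat_irr1),     *)
(* so Num.truncn only casts chi 1%g to nat (truncnK).                         *)
Theorem theoremB (gT : finGroupType) (G : {group gT}) (chi : 'CF(G))
    (solG : solvable G) (irr_chi : chi \in irr G) :
  (size (primes (Num.truncn (chi 1%g))) <= eta chi)%N /\
  (supersolvable G -> 1 < chi 1%g ->
    exists s : seq nat,
      [/\ all prime s, chi 1%g = (\prod_(p <- s) p)%N%:R
        & (size s <= eta chi - 1)%N]).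
Proof.
have /irrP[t Dchi] := irr_chi; have Nchi := irr_char t.
have Ct: t \in irr_constt ('Res[G] 'chi_t) by rewrite cfRes_id constt_irr inE.
rewrite {}Dchi; split.
  have [s chief_s lastG] := chief_series_exists (normal_refl G).
  have:= chief_series_primes_leq Nchi solG chief_s; rewrite lastG.
  by case/(_ t Ct)=> d ->; rewrite natrK card_constt_kerG // addn0.
case=> s cyc_s lastG chi_gt1.
have:= cyclic_series_prime_product_bound Nchi cyc_s; rewrite lastG.
case/(_ t Ct)=> r [pr_r Dr]; rewrite card_constt_kerG // addn0 => le_r.
(* A degree above 1 makes [r] nonempty, so the extra summand is 1 and gives the [- 1]. *)
exists r; split=> //; move: le_r; have -> : r != [::].
  apply: contraTneq chi_gt1 => r0.
  by rewrite Dr r0 big_nil Order.POrderTheory.ltxx.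
by rewrite addn1 subn1; case: (eta _).
Qed.
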